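(* Let $(S^6,g,J,\omega)$ be the standard nearly Kähler structure on the unit $6$-sphere and let $\psi\in\mathrm{Aut}(TS^6)$ be any $g$-Codazzi map. Then the almost complex structure $J^\psi:=\psi\circ J\circ\psi^{-1}$ is nonintegrable.
   Context: $\mathrm{Aut}(TM)$ denotes the smooth vector bundle automorphisms of $TM$ covering the identity of $M$. For a Riemannian manifold $(M,g)$ with Levi-Civita connection $\nabla^g$, a $g$-Codazzi map is an element $\psi\in\mathrm{Aut}(TM)$ such that $(\nabla^g_X\psi^{-1})Y=(\nabla^g_Y\psi^{-1})X$ for all vector fields $X,Y$, where $(\nabla^g_X\psi^{-1})Y:=\nabla^g_X(\psi^{-1}Y)-\psi^{-1}(\nabla^g_XY)$. Standard nearly Kähler structure on $S^6$: $S^6\subset\mathbb{R}^7$ is the unit sphere, $g$ is the round metric induced from the Euclidean inner product $\langle\cdot,\cdot\rangle$ on $\mathbb{R}^7$, $\times:\mathbb{R}^7\times\mathbb{R}^7\to\mathbb{R}^7$ is a $7$-dimensional cross product (a bilinear map such that $u\times v$ is orthogonal to $u$ and $v$ and $|u\times v|^2=|u|^2|v|^2-\langle u,v\rangle^2$), $J_p(v):=p\times v$ for $p\in S^6$ and $v\in T_pS^6$, and $\omega:=g(J\cdot,\cdot)$. An almost complex structure $I$ is integrable if and only if its Nijenhuis tensor $N_I(X,Y):=I[IX,Y]+I[X,IY]+[X,Y]-[IX,IY]$ vanishes identically; otherwise it is nonintegrable. *)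

(* Defs.v *)
From HB Require Import structures.
From mathcomp Require Import all_boot all_order all_algebra.
From mathcomp Require Import all_classical all_reals all_analysis.

Set Implicit Arguments.
Unset Strict Implicit.
Unset Printing Implicit Defensive.

Import Order.TTheory GRing.Theory Num.Theory.
Import numFieldNormedType.Exports.

Local Open Scope classical_set_scope.
Local Open Scope ring_scope.

(* C^k on an open subset U of a finite-dimensional space V. *)
Fixpoint Ck_on (R : realType) (V W : normedModType R) (k : nat) (U : set V)
    (f : V -> W) : Prop :=
  match k with
  | 0 => forall x, U x -> {for x, continuous f}
  | k'.+1 => (forall x, U x -> differentiable f x) /\
             (forall v : V, Ck_on k' U (fun x => 'D_v f x))
  end.

(* Smoothness of a map defined on a subset of V (the image of the injection
   [emb]): locally it is the restriction of a C^oo map of the ambient space. *)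
Definition smooth_along (R : realType) (V W : normedModType R) (T : Type)
    (emb : T -> V) (f : T -> W) : Prop :=
  forall t : T, exists (U : set V) (F : V -> W),
    [/\ open U, U (emb t), forall k, Ck_on k U F
      & forall s, U (emb s) -> F (emb s) = f s].

(* The library norm of 'rV[R]_7 is the sup norm, hence the explicit Euclidean
   inner product. *)
Definition dot (R : realType) (u v : 'rV[R]_7) : R := \sum_i u 0 i * v 0 i.

Definition enorm (R : realType) (u : 'rV[R]_7) : R := Num.sqrt (dot u u).

Definition S6 (R : realType) := {x : 'rV[R]_7 | enorm x == 1}.

Definition tangent (R : realType) (p : S6 R) (v : 'rV[R]_7) : bool :=
  dot (val p) v == 0.

Definition TS6 (R : realType) :=
  {pv : S6 R * 'rV[R]_7 | tangent pv.1 pv.2}.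

Definition TS6_emb (R : realType) (t : TS6 R) : 'rV[R]_7 * 'rV[R]_7 :=
  (val (val t).1, (val t).2).

Definition smooth (R : realType) (W : normedModType R) (f : S6 R -> W) : Prop :=
  smooth_along (fun p : S6 R => val p : 'rV[R]_7) f.

(* df_p(v), as the derivative at t = 0 of f along the curve
   t |-> (p + t v) / |p + t v| of S^6, whose velocity at t = 0 is v when v is
   tangent at p (the default value p of [insubd] is only used when p + t v = 0,
   thus not near t = 0). *)
Definition tderiv (R : realType) (W : normedModType R) (f : S6 R -> W)
    (p : S6 R) (v : 'rV[R]_7) : W :=
  'D_v (fun x : 'rV[R]_7 => f (insubd p ((enorm x)^-1 *: x))) (val p).

Definition vector_field (R : realType) (X : S6 R -> 'rV[R]_7) : Prop :=
  (forall p, tangent p (X p)) /\ smooth X.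

(* The components in R^7 of [X, Y] are X(Y^i) - Y(X^i). *)
Definition lie_bracket (R : realType) (X Y : S6 R -> 'rV[R]_7) (p : S6 R)
    : 'rV[R]_7 :=
  tderiv Y p (X p) - tderiv X p (Y p).

(* Fields of endomorphisms of TS^6 are functions E : S6 R -> 'rV_7 -> 'rV_7 in
   which only the values E p v with v tangent at p are meaningful. *)
Definition act (R : realType) (E : S6 R -> 'rV[R]_7 -> 'rV[R]_7)
    (X : S6 R -> 'rV[R]_7) (p : S6 R) : 'rV[R]_7 := E p (X p).

Record bundle_map (R : realType) (E : S6 R -> 'rV[R]_7 -> 'rV[R]_7) : Prop :=
  BundleMap {
    bundle_map_tangent : forall p v, tangent p v -> tangent p (E p v);
    bundle_map_linear : forall p (a : R) u v, tangent p u -> tangent p v ->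
      E p (a *: u + v) = a *: E p u + E p v;
    bundle_map_smooth :
      smooth_along (@TS6_emb R) (fun t : TS6 R => E (val t).1 (val t).2)
  }.

Record tangent_aut (R : realType) := TangentAut {
  aut_fun : S6 R -> 'rV[R]_7 -> 'rV[R]_7;
  aut_inv : S6 R -> 'rV[R]_7 -> 'rV[R]_7;
  aut_fun_map : bundle_map aut_fun;
  aut_inv_map : bundle_map aut_inv;
  aut_funK : forall p v, tangent p v -> aut_inv p (aut_fun p v) = v;
  aut_invK : forall p v, tangent p v -> aut_fun p (aut_inv p v) = v
}.

Definition round_metric (R : realType) (p : S6 R) (u v : 'rV[R]_7) : R :=
  dot u v.

Record is_connection (R : realType)
    (nabla : (S6 R -> 'rV[R]_7) -> (S6 R -> 'rV[R]_7) -> (S6 R -> 'rV[R]_7))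
    : Prop := IsConnection {
  connection_field : forall X Y, vector_field X -> vector_field Y ->
    vector_field (nabla X Y);
  connectionDl : forall X X' Y p,
    vector_field X -> vector_field X' -> vector_field Y ->
    nabla (fun q => X q + X' q) Y p = nabla X Y p + nabla X' Y p;
  connectionZl : forall (f : S6 R -> R^o) X Y p,
    smooth f -> vector_field X -> vector_field Y ->
    nabla (fun q => (f q : R) *: X q) Y p = (f p : R) *: nabla X Y p;
  connectionDr : forall X Y Y' p,
    vector_field X -> vector_field Y -> vector_field Y' ->
    nabla X (fun q => Y q + Y' q) p = nabla X Y p + nabla X Y' p;
  connection_leibniz : forall (f : S6 R -> R^o) X Y p,
    smooth f -> vector_field X -> vector_field Y ->
    nabla X (fun q => (f q : R) *: Y q) p =
      (tderiv f p (X p) : R) *: Y p + (f p : R) *: nabla X Y p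
}.

Record is_levi_civita (R : realType) (g : S6 R -> 'rV[R]_7 -> 'rV[R]_7 -> R)
    (nabla : (S6 R -> 'rV[R]_7) -> (S6 R -> 'rV[R]_7) -> (S6 R -> 'rV[R]_7))
    : Prop := IsLeviCivita {
  levi_civita_connection : is_connection nabla;
  levi_civita_torsion_free : forall X Y p,
    vector_field X -> vector_field Y ->
    nabla X Y p - nabla Y X p = lie_bracket X Y p;
  levi_civita_metric : forall X Y Z p,
    vector_field X -> vector_field Y -> vector_field Z ->
    tderiv ((fun q => g q (Y q) (Z q)) : S6 R -> R^o) p (X p) =
      g p (nabla X Y p) (Z p) + g p (Y p) (nabla X Z p)
}.

Definition codazzi (R : realType)
    (nabla : (S6 R -> 'rV[R]_7) -> (S6 R -> 'rV[R]_7) -> (S6 R -> 'rV[R]_7))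
    (psi : tangent_aut R) : Prop :=
  forall X Y, vector_field X -> vector_field Y -> forall p,
    nabla X (act (aut_inv psi) Y) p - aut_inv psi p (nabla X Y p) =
    nabla Y (act (aut_inv psi) X) p - aut_inv psi p (nabla Y X p).

Record cross_product (R : realType)
    (cross : 'rV[R]_7 -> 'rV[R]_7 -> 'rV[R]_7) : Prop := CrossProduct {
  cross_linearl : forall v, linear (fun u => cross u v);
  cross_linearr : forall u, linear (cross u);
  cross_orthl : forall u v, dot (cross u v) u = 0;
  cross_orthr : forall u v, dot (cross u v) v = 0;
  cross_enorm : forall u v,
    enorm (cross u v) ^+ 2 = enorm u ^+ 2 * enorm v ^+ 2 - dot u v ^+ 2
}.

Definition standard_J (R : realType)
    (cross : 'rV[R]_7 -> 'rV[R]_7 -> 'rV[R]_7) (p : S6 R) (v : 'rV[R]_7)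
    : 'rV[R]_7 := cross (val p) v.

Definition conj_by (R : realType) (psi : tangent_aut R)
    (I : S6 R -> 'rV[R]_7 -> 'rV[R]_7) (p : S6 R) (v : 'rV[R]_7) : 'rV[R]_7 :=
  aut_fun psi p (I p (aut_inv psi p v)).

Definition nijenhuis (R : realType) (I : S6 R -> 'rV[R]_7 -> 'rV[R]_7)
    (X Y : S6 R -> 'rV[R]_7) (p : S6 R) : 'rV[R]_7 :=
  I p (lie_bracket (act I X) Y p) + I p (lie_bracket X (act I Y) p)
  + lie_bracket X Y p - lie_bracket (act I X) (act I Y) p.

Definition integrable_acs (R : realType) (I : S6 R -> 'rV[R]_7 -> 'rV[R]_7)
    : Prop :=
  forall X Y, vector_field X -> vector_field Y ->
  forall p, nijenhuis I X Y p = 0.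

(* Main.v *)
Require Import Defs.
From HB Require Import structures.
From mathcomp Require Import all_boot all_order all_algebra.
From mathcomp Require Import all_classical all_reals all_analysis.
From mathcomp Require Import ring lra.

(** Write A for the inverse of psi and phi(u,v,w) = <u x v, w> for the
    associated 3-form of the cross product, which is alternating.

    The Codazzi equation says that the connection psi o nabla o A is torsion
    free, that is, A[psi x, psi y] = nabla_{psi x} y - nabla_{psi y} x for all
    vector fields x and y ([codazzi_bracket]).  By the Koszul argument nabla is
    the tangential part of the derivative in R^7 ([levi_civita_tangential]), so
    each bracket of fields of the form psi x is an explicit expression in the
    derivatives of x and y; and if x is replaced by Jx, the product rule
    for Jx, whose derivative along v at p is J(dx(v)) plus the cross product of
    v and x(p), produces one term without derivatives.  Apply A
    to the Nijenhuis tensor of J^psi evaluated at psi x and psi y, whose images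
    under J^psi are psi Jx and psi Jy.  All the derivatives cancel, and what
    remains is a pointwise condition on L = psi J + J psi: for all tangent
    vectors a and b at a point, La x b and Lb x a have the same tangential part
    ([nijenhuis_identity]).

    This condition forces L = 0 ([cross_exchange_eq0]).  Indeed, together with
    the alternation of phi it gives phi(La,b,c) = - phi(Lb,c,a), and applying
    this three times gives phi(La,b,c) = - phi(La,b,c).  So the tangential part
    of La x b vanishes for each tangent b; for b orthogonal to La and to J(La),
    the vector La x b is tangent and has norm |La||b|, whence La = 0.

    Therefore an integrable J^psi satisfies psi J = - J psi at every point,
    that is, J^psi = - J ([codazzi_integrable_anticommute]).  The Nijenhuis
    tensor is even in the almost complex structure, so J is integrable too.
    The same argument with the identity in the place of psi then yields
    J + J = 0, which is absurd ([standard_J_nonintegrable]). *)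

Set Implicit Arguments.
Unset Strict Implicit.
Unset Printing Implicit Defensive.

Import Order.TTheory GRing.Theory Num.Theory.
Import numFieldNormedType.Exports.

Local Open Scope classical_set_scope.
Local Open Scope ring_scope.

(** * Maps of class C^k *)

(** Differentiability is local: the difference of the two maps vanishes near x,
    so it is differentiable there with zero differential. *)
Lemma near_differentiable (R : realType) (V W : normedModType R)
    (f g : V -> W) (x : V) :
  {near x, f =1 g} -> differentiable f x -> differentiable g x.
Proof.
move=> fg df.
have h0 : {near x, (g \- f) =1 cst 0}.
  by apply: filterS fg => y /= ->; rewrite subrr.
have hx0 : (g \- f) x = 0 by exact: (nbhs_singleton h0).
have ho : (g \- f) \o shift x = cst ((g \- f) x) + (\0 : V -> W) +o_ 0 id.
  apply/eqaddoE; rewrite hx0 funeqE => z /=.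
  rewrite !fctE !add0r littleoE // => _/posnumP[e].
  move/nbhs0P : h0 => h0.
  apply: filterS h0 => y /= h0.
  by rewrite (_ : _ + _ = 0) ?normr0 ?mulr_ge0// -[RHS]h0 [y + x]addrC.
have -> : g = f + (g \- f).
  by rewrite funeqE => y; rewrite !fctE addrC subrK.
apply: differentiableD => //; apply/diff_locallyP.
have -> := @diff_unique _ _ _ _ (\0 : {linear V -> W}) x _ ho.
  by split => //; exact: cst_continuous.
exact: cst_continuous.
Qed.

Lemma linear_is_diff (R : realType) (V W : normedModType R) (L : V -> W) x :
  linear L -> continuous L -> is_diff x L L.
Proof.
move=> Llin Lc.
pose LM := GRing.isLinear.Build _ _ _ _ _ Llin.
pose LL : {linear _ -> _} := HB.pack L LM.
by apply: DiffDef; [exact: (@linear_differentiable _ _ _ LL)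
                   |exact: (@diff_lin _ _ _ LL)].
Qed.

Lemma bilinear_is_diff (R : realType) (U V W : normedModType R)
    (B : U -> V -> W) (T : normedModType R) (f : T -> U) (g : T -> V) x :
  (forall v, linear (B ^~ v)) -> (forall u, linear (B u)) ->
  continuous (fun p => B p.1 p.2) ->
  differentiable f x -> differentiable g x ->
  is_diff x (fun t => B (f t) (g t))
    (fun v => B (f x) ('d g x v) + B ('d f x v) (g x)).
Proof.
move=> Bl Br Bc df dg.
pose BM := bilinear_isBilinear.Build R U V W *:%R *:%R B (Bl, Br).
pose BB : {bilinear _ -> _ -> _} := HB.pack B BM.
have dB : is_diff (f x, g x) (fun p => B p.1 p.2)
   (fun q => B (f x) q.2 + B q.1 (g x)).
  apply: DiffDef; first exact: (@differentiable_bilin _ _ _ _ BB).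
  by have := @diff_bilin _ _ _ _ BB (f x, g x) Bc.
have /differentiableP ? := df; have /differentiableP ? := dg.
have dp : is_diff x (fun y => (f y, g y)) (fun y => ('d f x y, 'd g x y)).
  exact: is_diff_pair.
exact: (@is_diff_comp _ _ _ _ _ _ _ _ _ dp dB).
Qed.

Section Smoothness.
Variable R : realType.

Lemma is_diff_derive (V W : normedModType R) (f df : V -> W) x v :
  is_diff x f df -> 'D_v f x = df v.
Proof. by move=> [d <-]; rewrite deriveE. Qed.

Lemma Ck_on_eq (V W : normedModType R) k (U : set V) (f g : V -> W) :
  open U -> (forall x, U x -> f x = g x) -> Ck_on k U f -> Ck_on k U g.
Proof.
move=> oU; elim: k f g => [|k IH] f g fg /=.
  move=> cf x Ux; rewrite /prop_for /continuous_at -(fg x Ux).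
  apply: cvg_trans (cf x Ux); apply: near_eq_cvg.
  by apply: filterS (open_nbhs_nbhs (conj oU Ux)) => y /fg.
have near_fg x : U x -> {near x, f =1 g}.
  by move=> Ux; apply: filterS (open_nbhs_nbhs (conj oU Ux)) => y /fg.
move=> [df Df]; split=> [x Ux|v].
  exact: near_differentiable (near_fg x Ux) (df x Ux).
apply: IH (Df v) => x Ux; apply: near_eq_derive; exact: near_fg.
Qed.

Lemma Ck_on_sub (V W : normedModType R) k (U U' : set V) (f : V -> W) :
  U' `<=` U -> Ck_on k U f -> Ck_on k U' f.
Proof.
move=> UU'; elim: k f => [|k IH] f /=.
  by move=> cf x /UU'; exact: cf.
move=> [df Df]; split=> [x /UU'|v]; first exact: df.
exact: IH.
Qed.

Lemma Ck_onW (V W : normedModType R) k (U : set V) (f : V -> W) :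
  Ck_on k.+1 U f -> Ck_on k U f.
Proof.
elim: k f => [|k IH] f [df Df].
  by move=> x /df; exact: differentiable_continuous.
by split=> // v; apply: IH.
Qed.

Lemma Ck_on_cst (V W : normedModType R) k (U : set V) (c : W) :
  Ck_on k U (fun _ : V => c).
Proof.
elim: k c => [|k IH] c /=; first by move=> x _; exact: cst_continuous.
split=> [x _|v]; first exact: differentiable_cst.
suff -> : (fun x : V => 'D_v (fun=> c) x) = (fun=> 0) by exact: IH.
by rewrite funeqE => x; rewrite derive_cst.
Qed.

Lemma Ck_on_linear (V W : normedModType R) k (U : set V) (L : V -> W) :
  linear L -> continuous L -> Ck_on k U L.
Proof.
move=> Ll Lc; case: k => [|k] /=; first by move=> x _; exact: Lc.
split=> [x _|v]; first by have [] := linear_is_diff x Ll Lc.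
suff -> : (fun x : V => 'D_v L x) = (fun=> L v) by exact: Ck_on_cst.
by rewrite funeqE => x; rewrite (is_diff_derive _ (linear_is_diff x Ll Lc)).
Qed.

Lemma Ck_onD (V W : normedModType R) k (U : set V) (f g : V -> W) :
  open U -> Ck_on k U f -> Ck_on k U g -> Ck_on k U (fun x => f x + g x).
Proof.
move=> oU; elim: k f g => [|k IH] f g /=.
  by move=> cf cg x Ux; apply: continuousD; [exact: cf|exact: cg].
move=> [df Df] [dg Dg]; split=> [x Ux|v].
  by apply: differentiableD; [exact: df|exact: dg].
apply: (@Ck_on_eq _ _ _ _ (fun x => 'D_v f x + 'D_v g x)) => // [x Ux|].
  rewrite (@deriveD _ _ _ f g)//; apply: diff_derivable; [exact: df|exact: dg].
exact: IH.
Qed.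

Lemma Ck_on_sum (V W : normedModType R) k (U : set V) n (f : 'I_n -> V -> W) :
  open U -> (forall i, Ck_on k U (f i)) ->
  Ck_on k U (fun x => \sum_(i < n) f i x).
Proof.
move=> oU; elim: n f => [|n IH] f Cf.
  apply: (@Ck_on_eq _ _ _ _ (fun=> 0)) => // [x _|]; first by rewrite big_ord0.
  exact: Ck_on_cst.
apply: (@Ck_on_eq _ _ _ _ (fun x => f ord0 x + \sum_i f (lift ord0 i) x)) => //.
  by move=> x _; rewrite big_ord_recl.
by apply: Ck_onD => //; apply: IH.
Qed.

Lemma Ck_on_linear_comp (V W Z : normedModType R) k (U : set V) (L : W -> Z)
    (f : V -> W) :
  open U -> linear L -> continuous L -> Ck_on k U f ->
  Ck_on k U (fun x => L (f x)).
Proof.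
move=> oU Ll Lc; elim: k f => [|k IH] f /=.
  by move=> cf x Ux; apply: continuous_comp; [exact: cf|exact: Lc].
move=> [df Df]; split=> [x Ux|v].
  by apply: differentiable_comp; [exact: df|have [] := linear_is_diff (f x) Ll Lc].
apply: (@Ck_on_eq _ _ _ _ (fun x => L ('D_v f x))) => // [x Ux|]; last exact: IH.
have /differentiableP dfx := df x Ux.
have dL := linear_is_diff (f x) Ll Lc.
by rewrite (is_diff_derive v (is_diff_comp dfx dL)) /= -deriveE//; exact: df.
Qed.

(** The Leibniz rule, iterated.  Scalar multiples, inner products and cross
    products of maps of class C^k are all instances. *)
Lemma Ck_on_bilinear (T U V W : normedModType R) k (A : set T)
    (B : U -> V -> W) (f : T -> U) (g : T -> V) :
  open A -> (forall v, linear (B ^~ v)) -> (forall u, linear (B u)) ->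
  continuous (fun p => B p.1 p.2) ->
  Ck_on k A f -> Ck_on k A g -> Ck_on k A (fun x => B (f x) (g x)).
Proof.
move=> oA Bl Br Bc; elim: k f g => [|k IH] f g.
  move=> cf cg x Ax.
  apply: (@continuous_comp _ _ _ (fun y => (f y, g y)) (fun p => B p.1 p.2)).
    by apply: cvg_pair; [exact: cf|exact: cg].
  exact: Bc.
move=> Cf Cg; have [df Df] := Cf; have [dg Dg] := Cg; split=> [x Ax|v].
  by have [] := bilinear_is_diff Bl Br Bc (df x Ax) (dg x Ax).
apply: (@Ck_on_eq _ _ _ _ (fun x => B (f x) ('D_v g x) + B ('D_v f x) (g x))) => //.
  move=> x Ax.
  rewrite (is_diff_derive v (bilinear_is_diff Bl Br Bc (df x Ax) (dg x Ax))).
  by rewrite (deriveE _ (df x Ax)) (deriveE _ (dg x Ax)).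
by apply: Ck_onD => //; apply: IH; first [exact: Ck_onW|exact: Df|exact: Dg].
Qed.

Lemma Ck_on_pair (T U V : normedModType R) k (A : set T)
    (f : T -> U) (g : T -> V) :
  open A -> Ck_on k A f -> Ck_on k A g -> Ck_on k A (fun x => (f x, g x)).
Proof.
move=> oA; elim: k f g => [|k IH] f g.
  by move=> cf cg x Ax; apply: cvg_pair; [exact: cf|exact: cg].
move=> [df Df] [dg Dg]; split=> [x Ax|v].
  by apply: differentiable_pair; [exact: df|exact: dg].
apply: (@Ck_on_eq _ _ _ _ (fun x => ('D_v f x, 'D_v g x))) => // [x Ax|].
  have [] := (differentiableP (df x Ax), differentiableP (dg x Ax)) => d1 d2.
  rewrite (is_diff_derive v (is_diff_pair d1 d2)).
  by rewrite (deriveE _ (df x Ax)) (deriveE _ (dg x Ax)).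
by apply: IH; [exact: Df|exact: Dg].
Qed.

(** The iterated chain rule.  The direction [D_v f x] in which F has to be
    differentiated varies with x; expanding it in the basis e, with coordinates
    c, gives D_v (F o f) = sum_i c_i(D_v f) (D_{e_i} F) o f, to which the
    induction hypothesis applies because now only fixed directions occur. *)
Lemma Ck_on_comp (T V W : normedModType R) n (e : 'I_n -> V)
    (c : 'I_n -> V -> R^o) k (A : set T) (B : set V) (f : T -> V) (F : V -> W) :
  open A -> open B ->
  (forall i, linear (c i)) -> (forall i, continuous (c i)) ->
  (forall v, v = \sum_i (c i v : R) *: e i) ->
  (forall x, A x -> B (f x)) ->
  Ck_on k A f -> Ck_on k B F -> Ck_on k A (fun x => F (f x)).
Proof.
move=> oA oB cl cc ce AB; elim: k W F => [|k IH] W F.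
  move=> cf cF x Ax; apply: continuous_comp; [exact: cf|apply: cF; exact: AB].
move=> Cf CF; have [df Df] := Cf; have [dF DF] := CF.
have dFx x : A x -> differentiable F (f x) by move=> ?; apply: dF; exact: AB.
split=> [x Ax|v].
  by apply: differentiable_comp; [exact: df|exact: dFx].
pose s x := \sum_i (c i ('D_v f x) : R) *: 'D_(e i) F (f x).
apply: (@Ck_on_eq _ _ _ _ s) => // [x Ax|].
  have [] := (differentiableP (df x Ax), differentiableP (dFx x Ax)) => d1 d2.
  rewrite (is_diff_derive v (is_diff_comp d1 d2)) /s /= -(deriveE _ (df x Ax)).
  rewrite [in RHS](ce ('D_v f x)) linear_sum; apply: eq_bigr => i _.
  by rewrite linearZ /= -(deriveE _ (dFx x Ax)).
apply: Ck_on_sum => // i.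
apply: (@Ck_on_bilinear _ R^o _ _ _ _ (fun (a : R^o) w => (a : R) *: w)) => //.
- by move=> w a u u'; rewrite scalerDl scalerA.
- by move=> a b u u'; rewrite scalerDr !scalerA mulrC.
- by move=> p; exact: scale_continuous.
- by apply: Ck_on_linear_comp => //; exact: Df.
- by apply: (IH _ (fun y => 'D_(e i) F y)); [exact: Ck_onW|exact: DF].
Qed.

End Smoothness.

(** * Multilinear algebra in finite dimension *)

Section FiniteDimension.
Variable R : realType.

Lemma rV_linear_continuous n (W : normedModType R) (L : 'rV[R]_n -> W) :
  linear L -> continuous L.
Proof.
move=> Ll.
pose LM := GRing.isLinear.Build _ _ _ _ _ Ll.
pose LL : {linear _ -> _} := HB.pack L LM.
have -> : L = fun u => \sum_i u 0 i *: L (delta_mx 0 i).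
  rewrite funeqE => u; rewrite -[L]/(LL : _ -> _) {1}(row_sum_delta u) linear_sum.
  by apply: eq_bigr => i _; rewrite linearZ.
refine (continuous_big add_continuous _) => i _ u.
by apply: continuousZr_tmp; exact: coord_continuous.
Qed.

Lemma rV_bilinear_continuous m n (W : normedModType R)
    (B : 'rV[R]_m -> 'rV[R]_n -> W) :
  (forall v, linear (B ^~ v)) -> (forall u, linear (B u)) ->
  continuous (fun p => B p.1 p.2).
Proof.
move=> Bl Br.
have -> : (fun p => B p.1 p.2) =
    fun p => \sum_i p.1 0 i *: B (delta_mx 0 i) p.2.
  rewrite funeqE => -[u v] /=.
  pose LM := GRing.isLinear.Build _ _ _ _ _ (Bl v).
  pose LL : {linear _ -> _} := HB.pack (B ^~ v) LM.
  rewrite -[LHS]/(LL u) {1}(row_sum_delta u) linear_sum.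
  by apply: eq_bigr => i _; rewrite linearZ.
refine (continuous_big add_continuous _) => i _ p.
apply: (@cvgZ _ _ _ _ _ (fun q : 'rV[R]_m * 'rV[R]_n => q.1 0 i)
                     (fun q => B (delta_mx 0 i) q.2)).
  apply: (@cvg_comp _ _ _ fst (fun u : 'rV[R]_m => u 0 i) _ (nbhs p.1)).
    exact: cvg_fst.
  exact: coord_continuous.
apply: (@cvg_comp _ _ _ snd (B (delta_mx 0 i)) _ (nbhs p.2)); first exact: cvg_snd.
exact: rV_linear_continuous.
Qed.

End FiniteDimension.

Section Euclidean.
Variable R : realType.
Implicit Types u v w : 'rV[R]_7.

Lemma dotC u v : dot u v = dot v u.
Proof. by apply: eq_bigr => i _; rewrite mulrC. Qed.

Lemma dotDl u v w : dot (u + v) w = dot u w + dot v w.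
Proof. by rewrite /dot -big_split; apply: eq_bigr => i _; rewrite mxE mulrDl. Qed.

Lemma dotZl a u w : dot (a *: u) w = a * dot u w.
Proof. by rewrite /dot big_distrr; apply: eq_bigr => i _; rewrite mxE /= mulrA. Qed.

Lemma dotDr u v w : dot w (u + v) = dot w u + dot w v.
Proof. by rewrite !(dotC w) dotDl. Qed.

Lemma dotZr a u w : dot w (a *: u) = a * dot w u.
Proof. by rewrite !(dotC w) dotZl. Qed.

Lemma dotNl u w : dot (- u) w = - dot u w.
Proof. by rewrite -scaleN1r dotZl mulN1r. Qed.

Lemma dotNr u w : dot w (- u) = - dot w u.
Proof. by rewrite !(dotC w) dotNl. Qed.

Lemma dot0l w : dot 0 w = 0.
Proof. by rewrite -(scale0r 0) dotZl mul0r. Qed.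

Lemma dot0r w : dot w 0 = 0.
Proof. by rewrite dotC dot0l. Qed.

Definition dotE := (dotDl, dotDr, dotNl, dotNr, dotZl, dotZr, dot0l, dot0r).

Lemma dot_ge0 u : 0 <= dot u u.
Proof. by apply: sumr_ge0 => i _; rewrite -expr2 sqr_ge0. Qed.

Lemma dot_eq0 u : dot u u = 0 -> u = 0.
Proof.
move=> /eqP; rewrite psumr_eq0 => [|i _]; last by rewrite -expr2 sqr_ge0.
move=> /allP u0; apply/rowP => i; rewrite mxE.
by have := u0 i; rewrite mem_index_enum -expr2 sqrf_eq0 => /(_ isT)/eqP.
Qed.

(** Identities between vectors are proved by pairing both sides with an
    arbitrary vector, which turns them into identities between scalars. *)
Lemma dot_ext u v : (forall w, dot u w = dot v w) -> u = v.
Proof.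
move=> uv; apply/subr0_eq/dot_eq0; rewrite dotDl dotNl uv; exact: subrr.
Qed.

Lemma sqr_enorm u : enorm u ^+ 2 = dot u u.
Proof. by rewrite sqr_sqrtr// dot_ge0. Qed.

Lemma dot_linearl v : linear (fun u => dot u v : R^o).
Proof. by move=> a x y; rewrite dotDl dotZl. Qed.

Lemma dot_linearr u : linear (fun v => dot u v : R^o).
Proof. by move=> a x y; rewrite dotDr dotZr. Qed.

End Euclidean.

(** * Derivatives of maps on the sphere *)

Section Sphere.
Variable R : realType.
Implicit Types (p q : S6 R) (u v w : 'rV[R]_7).

Lemma enorm_S6 p : enorm (val p) = 1.
Proof. exact/eqP/(valP p). Qed.

Lemma dot_S6 p : dot (val p) (val p) = 1.
Proof. by rewrite -sqr_enorm enorm_S6 expr1n. Qed.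

Definition normalize v : 'rV[R]_7 := (enorm v)^-1 *: v.

Lemma normalize_S6 p : normalize (val p) = val p.
Proof. by rewrite /normalize enorm_S6 invr1 scale1r. Qed.

Lemma enorm_normalize v : 0 < enorm v -> enorm (normalize v) = 1.
Proof.
move=> v0; rewrite /normalize {1}/enorm dotZl dotZr mulrA -expr2.
by rewrite -sqr_enorm -exprMn mulVf ?gt_eqF// expr1n sqrtr1.
Qed.

(** The differential of the radial retraction at a point of the sphere is the
    orthogonal projection onto the tangent space. *)
Lemma is_diff_normalize p :
  is_diff (val p) normalize (fun v => v - dot (val p) v *: val p).
Proof.
set P := val p.
have d1 : is_diff P (fun x => dot x x : R) (fun v => dot P v + dot v P).
  have [d1 d2] := is_diff_id P.
  have := bilinear_is_diff (@dot_linearl R) (@dot_linearr R)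
    (rV_bilinear_continuous (@dot_linearl R) (@dot_linearr R)) d1 d1.
  by rewrite d2.
(* Since dot P P = 1, the derivative of 1/sqrt there is -1/2. *)
have ds : is_diff (dot P P : R) (fun s : R => (Num.sqrt s)^-1)
                  (fun h => - (2^-1 * h)).
  have s1 : 0 < dot P P by rewrite dot_S6.
  have [s2 s3] := is_derive1_sqrt s1.
  have s4 : Num.sqrt (dot P P) != 0 by rewrite dot_S6 sqrtr1 oner_eq0.
  have dv : derivable (fun s : R => (Num.sqrt s)^-1) (dot P P) 1.
    exact: derivableV.
  apply: DiffDef; first exact/derivable1_diffP.
  rewrite (deriv1E dv) derive1E deriveV// s3 dot_S6 sqrtr1 funeqE => h.
  by rewrite /GRing.scale /=; field.
have dc := is_diff_comp d1 ds.
have [e1 e2] := dc.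
have [f1 f2] := is_diff_id P.
have Zl (v : 'rV[R]_7) : linear (fun a : R^o => (a : R) *: v).
  by move=> a u u'; rewrite scalerDl scalerA.
have Zr (a : R^o) : linear (fun v : 'rV[R]_7 => (a : R) *: v).
  by move=> b u u'; rewrite scalerDr !scalerA mulrC.
have dn := bilinear_is_diff Zl Zr (@scale_continuous _ _) e1 f1.
apply: (is_diff_eq dn); rewrite funeqE => v; rewrite e2 f2 /=.
rewrite dot_S6 sqrtr1 invr1 scale1r (dotC v).
have -> : - (2^-1 * (dot P v + dot P v)) = - dot P v :> R by field.
by rewrite scaleNr.
Qed.

(** The extension of f that is constant along rays, up to the point p at which
    it is used: p is the default value where the ray is undefined.  The
    derivative [tderiv f p v] is that of this extension. *)
Definition pull (W : Type) p (f : S6 R -> W) v : W := f (insubd p (normalize v)).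

Lemma pull_val (W : Type) p (f : S6 R -> W) : pull p f (val p) = f p.
Proof. by rewrite /pull normalize_S6 valKd. Qed.

(** The default value in [insubd] is not reached near p: the half-space
    <p, x> > 0 does not contain 0. *)
Lemma near_val_insubd p :
  \forall x \near val p, val (insubd p (normalize x)) = normalize x.
Proof.
have H : \forall x \near val p, 0 < dot (val p) x.
  have /(_ [set x | 0 < x]) := rV_linear_continuous (@dot_linearr R (val p)) (x := val p).
  by rewrite dot_S6; apply; exact: (open_nbhs_nbhs (conj (@open_gt _ 0) ltr01)).
apply: filterS H => x /= x0; rewrite val_insubd enorm_normalize ?eqxx//.
rewrite sqrtr_gt0 lt_neqAle dot_ge0 andbT eq_sym.
by apply: contraTneq x0 => /dot_eq0 ->; rewrite dot0r ltxx.
Qed.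

Variable W : normedModType R.

(** Near p, the radial extension is the composition of any local smooth
    extension of f with the radial retraction. *)
Lemma pull_differentiable p (f : S6 R -> W) :
  smooth f -> differentiable (pull p f) (val p).
Proof.
move=> /(_ p)[U [F [oU Up CF Ff]]].
have [dN _] := is_diff_normalize p.
apply: (@near_differentiable _ _ _ (F \o normalize)).
  have cN := differentiable_continuous dN.
  have : \forall x \near val p, U (normalize x).
    move: (cN U); rewrite normalize_S6; apply; exact: open_nbhs_nbhs.
  move=> H; apply: filterS (filterI (near_val_insubd p) H) => x [x1 x2].
  by have := Ff (insubd p (normalize x)); rewrite x1 => /(_ x2).
apply: differentiable_comp => //; rewrite normalize_S6.
by have [+ _] := CF 1; apply.
Qed.

Lemma tderivE p (f : S6 R -> W) v :
  smooth f -> tderiv f p v = 'd (pull p f) (val p) v.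
Proof. by move=> /(pull_differentiable p) df; rewrite -deriveE. Qed.

Lemma tderiv_dirN p (f : S6 R -> W) v : smooth f ->
  tderiv f p (- v) = - tderiv f p v.
Proof. by move=> sf; rewrite !tderivE// linearN. Qed.

Lemma tderivN p (f : S6 R -> W) v : smooth f ->
  tderiv (fun q => - f q) p v = - tderiv f p v.
Proof.
move=> sf; rewrite /tderiv deriveN//; apply: diff_derivable.
exact: pull_differentiable.
Qed.

End Sphere.

Lemma tderiv_val (R : realType) (p : S6 R) v : tangent p v ->
  tderiv (fun q : S6 R => val q : 'rV[R]_7) p v = v.
Proof.
move=> /eqP tv; rewrite /tderiv (near_eq_derive v (near_val_insubd p)).
by rewrite (is_diff_derive v (is_diff_normalize p)) tv scale0r subr0.
Qed.

Lemma tderiv_bilinear (R : realType) (U V W : normedModType R)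
    (B : U -> V -> W) p (f : S6 R -> U) (g : S6 R -> V) v :
  (forall v, linear (B ^~ v)) -> (forall u, linear (B u)) ->
  continuous (fun p => B p.1 p.2) -> smooth f -> smooth g ->
  tderiv (fun q => B (f q) (g q)) p v =
  B (f p) (tderiv g p v) + B (tderiv f p v) (g p).
Proof.
move=> Bl Br Bc sf sg; rewrite (tderivE p v sf) (tderivE p v sg).
have df := pull_differentiable p sf; have dg := pull_differentiable p sg.
rewrite -[f p](pull_val p f) -[g p](pull_val p g).
exact: (is_diff_derive v (bilinear_is_diff Bl Br Bc df dg)).
Qed.

(** * Smooth vector fields *)

Section VectorFields.
Variable R : realType.

Lemma tangentD p (u v : 'rV[R]_7) : tangent p u -> tangent p v -> tangent p (u + v).
Proof. by rewrite /tangent dotDr => /eqP-> /eqP->; rewrite addr0. Qed.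

Lemma tangentN p (u : 'rV[R]_7) : tangent p u -> tangent p (- u).
Proof. by rewrite /tangent dotNr oppr_eq0. Qed.

Lemma bundle_mapD (E : S6 R -> 'rV[R]_7 -> 'rV[R]_7) p u v : bundle_map E -> tangent p u -> tangent p v ->
  E p (u + v) = E p u + E p v.
Proof.
by move=> bE tu tv; have := bundle_map_linear bE 1 tu tv; rewrite !scale1r.
Qed.

Lemma bundle_map0 (E : S6 R -> 'rV[R]_7 -> 'rV[R]_7) p : bundle_map E -> E p 0 = 0.
Proof.
move=> bE; have t0 : tangent p 0 by rewrite /tangent dot0r.
have := bundle_mapD bE t0 t0; rewrite addr0 => /eqP.
by rewrite -subr_eq subrr eq_sym => /eqP.
Qed.

Lemma bundle_mapN (E : S6 R -> 'rV[R]_7 -> 'rV[R]_7) p u : bundle_map E -> tangent p u ->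
  E p (- u) = - E p u.
Proof.
move=> bE tu; have t0 : tangent p 0 by rewrite /tangent dot0r.
have := bundle_map_linear bE (-1) tu t0.
by rewrite bundle_map0// !addr0 !scaleN1r.
Qed.

Lemma smooth_val : smooth (fun q : S6 R => val q : 'rV[R]_7).
Proof.
move=> p; exists setT, id; split=> //; first exact: openT.
by move=> k; apply: Ck_on_linear => // x; exact: cvg_id.
Qed.

Lemma smooth_bilinear (U V W : normedModType R) (B : U -> V -> W)
    (f : S6 R -> U) (g : S6 R -> V) :
  (forall v, linear (B ^~ v)) -> (forall u, linear (B u)) ->
  continuous (fun p => B p.1 p.2) -> smooth f -> smooth g ->
  smooth (fun q => B (f q) (g q)).
Proof.
move=> Bl Br Bc sf sg p.
have [A [F [oA Ap CF Ff]]] := sf p; have [A' [G [oA' A'p CG Gg]]] := sg p.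
exists (A `&` A'), (fun x => B (F x) (G x)); split=> // [|k|s [As A's]].
- exact: openI.
- by apply: Ck_on_bilinear => //; [exact: openI|exact: Ck_on_sub (CF k)|
    exact: Ck_on_sub (CG k)].
- by rewrite Ff// Gg.
Qed.

Lemma vector_fieldN (X : S6 R -> 'rV[R]_7) :
  vector_field X -> vector_field (fun q => - X q).
Proof.
move=> [tX sX]; split=> [p|p]; first by rewrite /tangent dotNr oppr_eq0; exact: tX.
have [U [F [oU Up CF FX]]] := sX p.
have Nl : linear (fun v : 'rV[R]_7 => - v).
  by move=> a u v; rewrite opprD scalerN.
exists U, (fun x => - F x); split=> // [k|q /FX -> //].
apply: (Ck_on_linear_comp (L := fun v => - v)) => //.
exact: rV_linear_continuous.
Qed.

(** The field q |-> u - <q, u> q, the tangential part of a constant field.  On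
    the sphere it is B(q, q) for the bilinear map
    B(x, y) = <x, y> u - <x, u> y, so its smoothness is that of a bilinear
    expression in the position vector. *)
Lemma tangent_field p (u : 'rV[R]_7) : tangent p u ->
  exists2 X, vector_field X & X p = u.
Proof.
move=> tu; pose B (x y : 'rV[R]_7) := dot x y *: u - dot x u *: y.
have Bl v : linear (B ^~ v).
  by move=> a x y; apply: dot_ext => w; rewrite !dotE; ring.
have Br v : linear (B v).
  by move=> a x y; apply: dot_ext => w; rewrite !dotE; ring.
exists (fun q => B (val q) (val q)).
  split=> [q|]; first by rewrite /tangent !dotE dot_S6; apply/eqP; ring.
  apply: smooth_bilinear => //; [exact: rV_bilinear_continuous|..];
  exact: smooth_val.
by rewrite /B dot_S6 scale1r (eqP tu) scale0r subr0.
Qed.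

Lemma open_preimage_on (V W : normedModType R) (A : set V) (B : set W)
    (f : V -> W) :
  open A -> open B -> (forall x, A x -> {for x, continuous f}) ->
  open (A `&` f @^-1` B).
Proof.
move=> oA oB cf; rewrite openE => x [Ax Bx]; rewrite /interior.
apply: filterI; first exact: open_nbhs_nbhs.
by apply: (cf x Ax); exact: open_nbhs_nbhs.
Qed.

(** Locally the field is q |-> G(q, F q), where F extends X near p and G extends
    E near (p, X p), so the chain rule applies on a neighbourhood of p which F
    maps into the domain of G. *)
Lemma bundle_map_field (E : S6 R -> 'rV[R]_7 -> 'rV[R]_7) X :
  bundle_map E -> vector_field X -> vector_field (act E X).
Proof.
move=> bE [tX sX]; split=> [p|p]; first exact: bundle_map_tangent.
have [A [F [oA Ap CF FX]]] := sX p.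
pose t q : TS6 R := exist _ (q, X q) (tX q).
have [B [G [oB Bp CG GE]]] := bundle_map_smooth bE (t p).
have CP k : Ck_on k A (fun x => (x, F x)).
  apply: Ck_on_pair => //; apply: Ck_on_linear => // x; exact: cvg_id.
have oC : open (A `&` (fun x => (x, F x)) @^-1` B).
  by apply: open_preimage_on => //; exact: (CP 0%N).
exists (A `&` (fun x => (x, F x)) @^-1` B), (fun x => G (x, F x)); split=> //.
- by split => //=; rewrite FX.
- move=> k.
  (* The standard basis of R^7 x R^7 and its coordinates. *)
  pose e (i : 'I_(7 + 7)) : 'rV[R]_7 * 'rV[R]_7 :=
    match fintype.split i with
    | inl j => (delta_mx 0 j, 0) | inr j => (0, delta_mx 0 j) end.
  pose c (i : 'I_(7 + 7)) (v : 'rV[R]_7 * 'rV[R]_7) : R^o :=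
    match fintype.split i with inl j => v.1 0 j | inr j => v.2 0 j end.
  apply: (@Ck_on_comp _ _ _ _ _ e c _ _ B) => //.
  + by move=> i a u v; rewrite /c; case: fintype.split => j; rewrite /= !mxE.
  + move=> i v; rewrite /c; case: fintype.split => j.
      by apply: (@cvg_comp _ _ _ fst (fun u : 'rV[R]_7 => u 0 j) _ (nbhs v.1));
        [exact: cvg_fst|exact: coord_continuous].
    by apply: (@cvg_comp _ _ _ snd (fun u : 'rV[R]_7 => u 0 j) _ (nbhs v.2));
      [exact: cvg_snd|exact: coord_continuous].
  + move=> [u v]; rewrite big_split_ord /=.
    have El j : (c (lshift 7 j) (u, v) : R) *: e (lshift 7 j) =
        (u 0 j *: delta_mx 0 j, 0).
      rewrite /c /e -[lshift _ _]/(unsplit (inl j)) unsplitK.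
      by congr pair; rewrite /= scaler0.
    have Er j : (c (rshift 7 j) (u, v) : R) *: e (rshift 7 j) =
        (0, v 0 j *: delta_mx 0 j).
      rewrite /c /e -[rshift _ _]/(unsplit (inr j)) unsplitK.
      by congr pair; rewrite /= scaler0.
    rewrite (eq_bigr _ (fun j _ => El j)) (eq_bigr _ (fun j _ => Er j)).
    rewrite [LHS]surjective_pairing [RHS]surjective_pairing /=.
    rewrite !(raddf_sum fst) !(raddf_sum snd) /= -!row_sum_delta.
    by rewrite !big1_eq addr0 add0r.
  + by move=> x [].
  + by apply: Ck_on_sub (CP k) => x [].
- move=> q [Aq Bq]; move: Bq; rewrite /= FX// => Bq.
  exact: (GE (t q)).
Qed.

End VectorFields.

(** * The Levi-Civita connection of the round metric *)

Section LeviCivita.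
Variable R : realType.
Variable nabla :
  (S6 R -> 'rV[R]_7) -> (S6 R -> 'rV[R]_7) -> (S6 R -> 'rV[R]_7).
Hypothesis Hnabla : is_levi_civita (@round_metric R) nabla.

Implicit Types X Y : S6 R -> 'rV[R]_7.

Lemma tderiv_dot X Y p v :
  smooth X -> smooth Y ->
  tderiv ((fun q => dot (X q) (Y q)) : S6 R -> R^o) p v =
  dot (X p) (tderiv Y p v) + dot (tderiv X p v) (Y p).
Proof.
move=> sX sY.
have Bl := @dot_linearl R; have Br := @dot_linearr R.
by rewrite (tderiv_bilinear p v Bl Br (rV_bilinear_continuous Bl Br) sX sY).
Qed.

(** Uniqueness of the Levi-Civita connection.  Both the connection and the
    derivative in R^7 satisfy the torsion and metric identities when tested
    against tangent fields; hence their difference, paired with a third field,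
    is symmetric in its first two arguments and skew in the last two, and such a
    trilinear expression vanishes. *)
Lemma levi_civita_tangential X Y p z :
  vector_field X -> vector_field Y -> tangent p z ->
  dot (nabla X Y p) z = dot (tderiv Y p (X p)) z.
Proof.
move=> vX vY tz; have [Z vZ <-] := tangent_field tz.
pose s A B C := dot (nabla A B p - tderiv B p (A p)) (C p).
have s_sym A B C : vector_field A -> vector_field B -> s A B C = s B A C.
  move=> vA vB; have := levi_civita_torsion_free Hnabla p vA vB.
  rewrite /s /lie_bracket => /(congr1 (fun v => dot v (C p))).
  by rewrite !dotE; lra.
have s_skew A B C : vector_field A -> vector_field B -> vector_field C ->
    s A B C = - s A C B.
  move=> vA vB vC; have := levi_civita_metric Hnabla p vA vB vC.
  have [_ sB] := vB; have [_ sC] := vC.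
  rewrite /round_metric tderiv_dot// /s !dotE (dotC (B p)) (dotC (B p)); lra.
(* Both sides of (12)(23)(12) = (23)(12)(23) are the same permutation of the
   arguments; s changes sign once along the first word, twice along the other. *)
have : s X Y Z = - s X Y Z.
  by rewrite {1}s_sym// s_skew// s_sym// s_skew// s_sym// s_skew// !opprK.
rewrite /s !dotE; lra.
Qed.

Variable psi : tangent_aut R.
Hypothesis Hpsi : codazzi nabla psi.
Notation ps := (aut_fun psi).
Notation A := (aut_inv psi).

Lemma nabla_tangent X Y p : vector_field X -> vector_field Y ->
  tangent p (nabla X Y p).
Proof.
by move=> vX vY; have [] := connection_field (levi_civita_connection Hnabla) vX vY.
Qed.

Lemma lie_bracket_tangent X Y p : vector_field X -> vector_field Y ->
  tangent p (lie_bracket X Y p).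
Proof.
move=> vX vY; rewrite -(levi_civita_torsion_free Hnabla)//.
by apply: tangentD; [|apply: tangentN]; exact: nabla_tangent.
Qed.

(** The Codazzi equation for psi x and psi y is the vanishing of the torsion of
    the conjugate connection psi o nabla o A: the terms A(nabla) in it add up to
    A of a bracket, since nabla itself has no torsion. *)
Lemma codazzi_bracket (x y : S6 R -> 'rV[R]_7) p z :
  vector_field x -> vector_field y -> tangent p z ->
  dot (A p (lie_bracket (act ps x) (act ps y) p)) z =
  dot (tderiv y p (ps p (x p))) z - dot (tderiv x p (ps p (y p))) z.
Proof.
move=> vx vy tz.
have vX := bundle_map_field (aut_fun_map psi) vx.
have vY := bundle_map_field (aut_fun_map psi) vy.
have AK w : vector_field w -> act A (act ps w) = w.
  by move=> [tw _]; rewrite funeqE => q; apply: aut_funK.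
have := Hpsi vX vY p; rewrite !AK// => E.
have T1 := nabla_tangent p vX vY; have T2 := nabla_tangent p vY vX.
rewrite -(levi_civita_torsion_free Hnabla)//.
rewrite (bundle_mapD (aut_inv_map psi))//; last exact: tangentN.
rewrite (bundle_mapN (aut_inv_map psi))//.
rewrite -[tderiv y p _]/(tderiv y p (act ps x p)).
rewrite -[tderiv x p _]/(tderiv x p (act ps y p)).
rewrite -!levi_civita_tangential//.
move/(congr1 (fun v => dot v z)): E; rewrite !dotE; lra.
Qed.

End LeviCivita.

(** * The cross product and the almost complex structure *)

Section Cross.
Variable R : realType.
Variable cross : 'rV[R]_7 -> 'rV[R]_7 -> 'rV[R]_7.
Hypothesis Hcross : cross_product cross.
Local Notation "u ** v" := (cross u v) (at level 40, left associativity).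

Implicit Types u v w : 'rV[R]_7.

Lemma crossDl u v w : (u + v) ** w = u ** w + v ** w.
Proof. by have := cross_linearl Hcross w 1 u v; rewrite !scale1r. Qed.

Lemma crossDr u v w : w ** (u + v) = w ** u + w ** v.
Proof. by have := cross_linearr Hcross w 1 u v; rewrite !scale1r. Qed.

Lemma dot_cross_swap23 u v w : dot (u ** v) w = - dot (u ** w) v.
Proof.
have := cross_orthr Hcross u (v + w).
by rewrite crossDr !dotE !(cross_orthr Hcross); lra.
Qed.

Lemma dot_cross_swap13 u v w : dot (u ** v) w = - dot (w ** v) u.
Proof.
have := cross_orthl Hcross (u + w) v.
by rewrite crossDl !dotE !(cross_orthl Hcross); lra.
Qed.

Lemma dot_cross_swap12 u v w : dot (u ** v) w = - dot (v ** u) w.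
Proof.
by rewrite dot_cross_swap23 dot_cross_swap13 dot_cross_swap23 !opprK.
Qed.

Lemma dot_cross_self u v : dot (u ** v) (u ** v) =
  dot u u * dot v v - dot u v ^+ 2.
Proof. by rewrite -!sqr_enorm (cross_enorm Hcross). Qed.

(** The norm identity polarized in the second factor; the next lemma polarizes
    it in the first factor as well. *)
Lemma dot_crossl u v w : dot (u ** v) (u ** w) =
  dot u u * dot v w - dot u v * dot u w.
Proof.
have := dot_cross_self u (v + w); rewrite crossDr !dotE !dot_cross_self.
rewrite (dotC (u ** w) (u ** v)) (dotC w v) !expr2; nra.
Qed.

Lemma dot_cross_polarized u v t w : dot (u ** v) (t ** w) + dot (t ** v) (u ** w) =
  2 * dot u t * dot v w - dot u v * dot t w - dot t v * dot u w.
Proof.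
have := dot_crossl (u + t) v w; rewrite !crossDl !dotE !dot_crossl.
rewrite (dotC t u); lra.
Qed.

Local Notation J := (standard_J cross).

Lemma J_tangent p v : tangent p (J p v).
Proof. by rewrite /tangent dotC /standard_J (cross_orthl Hcross). Qed.

Lemma J_field X : vector_field X -> vector_field (act J X).
Proof.
move=> [tX sX]; split=> [p|]; first exact: J_tangent.
have Bl := cross_linearl Hcross; have Br := cross_linearr Hcross.
apply: (smooth_bilinear Bl Br) => //; first exact: rV_bilinear_continuous.
exact: smooth_val.
Qed.

Lemma JJ p v : tangent p v -> J p (J p v) = - v.
Proof.
move=> /eqP tv; apply: dot_ext => w.
rewrite /standard_J dot_cross_swap23 dotC dot_crossl dot_S6 tv !dotE (dotC v).
lra.
Qed.

Lemma dot_J p u v : dot (J p u) v = - dot u (J p v).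
Proof. by rewrite /standard_J dot_cross_swap23 dotC. Qed.

(** The product rule for the field q |-> q x Y(q).  The term v x Y(p) is what
    makes J nonparallel: its tangential part is ((nabla_v J) Y)(p). *)
Lemma tderiv_J Y p v : vector_field Y -> tangent p v ->
  tderiv (act J Y) p v = J p (tderiv Y p v) + v ** Y p.
Proof.
move=> [_ sY] tv.
have Bl := cross_linearl Hcross; have Br := cross_linearr Hcross.
have := tderiv_bilinear p v Bl Br (rV_bilinear_continuous Bl Br) (@smooth_val R) sY.
by rewrite tderiv_val.
Qed.

(** On the tangent space, <u x v, w> is the real part of a form of type (3,0),
    so J can be moved from one argument to another.  Up to alternation this is the doubly
    polarized norm identity for p, u, v, z, whose right-hand side vanishes since
    p is orthogonal to the three tangent vectors. *)
Lemma dot_cross_J p u v z : tangent p u -> tangent p v -> tangent p z ->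
  dot (u ** v) (J p z) = dot (J p u ** v) z.
Proof.
rewrite /tangent /standard_J => /eqP tu /eqP tv /eqP tz.
have := dot_cross_polarized (val p) u v z; rewrite tu tv tz (dotC v u).
have := dot_cross_swap12 v u (val p ** z).
have := dot_cross_swap13 (val p ** u) v z.
have := dot_cross_swap12 z v (val p ** u).
rewrite (dotC (v ** z)); lra.
Qed.

Lemma exists_orthogonal3 (a b c : 'rV[R]_7) :
  exists2 y, y != 0 & [/\ dot a y = 0, dot b y = 0 & dot c y = 0].
Proof.
pose M := \matrix_(i < 7, j < 3) [:: a; b; c]`_j 0 i.
have kM : kermx M != 0.
  rewrite -mxrank_eq0 mxrank_ker subn_eq0 -ltnNge.
  by apply: leq_ltn_trans (rank_leq_col M) _.
exists (nz_row (kermx M)); first by rewrite nz_row_eq0.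
have := nz_row_sub (kermx M); rewrite sub_kermx => /eqP/matrixP E.
have D (j : 'I_3) : dot [:: a; b; c]`_j (nz_row (kermx M)) = 0.
  have := E 0 j; rewrite !mxE => <-; rewrite dotC.
  by apply: eq_bigr => i _; rewrite !mxE.
by split; [have := D 0|have := D 1|have := D (inord 2); rewrite inordK].
Qed.

(** If y is orthogonal to p, u and p x u, then u x y is tangent, as
    <u x y, p> = <p x u, y>, and |u x y| = |u||y|. *)
Lemma tangent_cross_eq0 p u : tangent p u ->
  (forall y z, tangent p y -> tangent p z -> dot (u ** y) z = 0) -> u = 0.
Proof.
move=> tu H.
have [y y0 [py uy puy]] := exists_orthogonal3 (val p) u (val p ** u).
have ty : tangent p y by apply/eqP.
have tuy : tangent p (u ** y).
  rewrite /tangent dotC dot_cross_swap23 dot_cross_swap12 opprK; exact/eqP.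
have := H _ _ ty tuy; rewrite dot_cross_self uy expr0n subr0 => /eqP.
rewrite mulf_eq0 => /orP[/eqP/dot_eq0//|/eqP/dot_eq0 yy].
by rewrite yy eqxx in y0.
Qed.

(** With phi(u,v,w) = <u x v, w>, the hypothesis and the alternation of phi give
    phi(La,b,c) = - phi(Lb,c,a); three cyclic permutations of the arguments
    produce an odd number of signs, so phi(Lu,y,z) = 0. *)
Lemma cross_exchange_eq0 p (L : 'rV[R]_7 -> 'rV[R]_7) :
  (forall u, tangent p u -> tangent p (L u)) ->
  (forall x y z, tangent p x -> tangent p y -> tangent p z ->
     dot (L x ** y) z = dot (L y ** x) z) ->
  forall u, tangent p u -> L u = 0.
Proof.
move=> tL H u tu; apply: (@tangent_cross_eq0 p); first exact: tL.
move=> y z ty tz.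
have sw a b c : tangent p a -> tangent p b -> tangent p c ->
    dot (L a ** b) c = - dot (L b ** c) a.
  by move=> ta tb tc; rewrite H// dot_cross_swap23.
have := sw u y z tu ty tz; have := sw y z u ty tz tu; have := sw z u y tz tu ty.
lra.
Qed.

End Cross.

(** * The Nijenhuis tensor *)

Section Nijenhuis.
Variable R : realType.
Variable cross : 'rV[R]_7 -> 'rV[R]_7 -> 'rV[R]_7.
Hypothesis Hcross : cross_product cross.
Variable nabla :
  (S6 R -> 'rV[R]_7) -> (S6 R -> 'rV[R]_7) -> (S6 R -> 'rV[R]_7).
Hypothesis Hnabla : is_levi_civita (@round_metric R) nabla.
Local Notation J := (standard_J cross).

(** The left-hand side is A of the Nijenhuis tensor of J^psi at psi x and psi y,
    paired with z, after the brackets have been computed.  At the point p, the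
    vectors X, X', Y, Y' are the values of psi x, psi Jx, psi y, psi Jy, and xY
    stands for the derivative of x along Y (likewise xY', yX, yX').  As J is
    skew with square -1 on tangent vectors, the derivatives cancel in pairs. *)
Lemma nijenhuis_identity p x y z X Y X' Y' xY xY' yX yX' :
  tangent p x -> tangent p y -> tangent p z -> tangent p X -> tangent p Y ->
  - (dot yX' (J p z) - dot (J p xY + cross Y x) (J p z))
  - (dot (J p yX + cross X y) (J p z) - dot xY' (J p z))
  + (dot yX z - dot xY z)
  - (dot (J p yX' + cross X' y) z - dot (J p xY' + cross Y' x) z) =
  dot (cross (J p Y) x) z - dot (cross (J p X) y) z
  - dot (cross X' y) z + dot (cross Y' x) z.
Proof.
move=> tx ty tz tX tY; rewrite !dotE !(dot_J Hcross) (JJ Hcross tz).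
rewrite (dot_cross_J Hcross tY tx tz) (dot_cross_J Hcross tX ty tz) !dotNr; lra.
Qed.

(** Testing integrability on fields psi x and psi y shows that L = psi J + J psi
    satisfies the exchange identity <La x b, c> = <Lb x a, c>. *)
Lemma codazzi_integrable_anticommute (psi : tangent_aut R) p u :
  codazzi nabla psi -> integrable_acs (conj_by psi J) -> tangent p u ->
  aut_fun psi p (J p u) + J p (aut_fun psi p u) = 0.
Proof.
move=> Hpsi Hint tu; set ps := aut_fun psi; set A := aut_inv psi.
have psT q v : tangent q v -> tangent q (ps q v).
  exact: (bundle_map_tangent (aut_fun_map psi)).
have JT := J_tangent Hcross.
apply: (cross_exchange_eq0 Hcross (p := p)
  (L := fun v => ps p (J p v) + J p (ps p v))) tu => [v tv|x0 y0 z tx ty tz].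
  by apply: tangentD => //; exact: psT.
have [x vx xp] := tangent_field tx; have [y vy yp] := tangent_field ty.
have vX := bundle_map_field (aut_fun_map psi) vx.
have vY := bundle_map_field (aut_fun_map psi) vy.
have vJx := J_field Hcross vx; have vJy := J_field Hcross vy.
have vX' := bundle_map_field (aut_fun_map psi) vJx.
have vY' := bundle_map_field (aut_fun_map psi) vJy.
have IE w : vector_field w -> act (conj_by psi J) (act ps w) = act ps (act J w).
  move=> [tw _]; rewrite funeqE => q.
  by rewrite /act /conj_by (aut_funK psi (tw q)).
have AI w : A p (conj_by psi J p w) = J p (A p w).
  by rewrite /A /conj_by aut_funK.
have br := codazzi_bracket Hnabla Hpsi (p := p).
have := Hint _ _ vX vY p; rewrite /nijenhuis !IE//.
set b1 := lie_bracket _ _ _; set b2 := lie_bracket _ _ _.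
set b3 := lie_bracket _ _ _; set b4 := lie_bracket _ _ _.
have tb1 : tangent p b1 by exact: (lie_bracket_tangent Hnabla).
have tb2 : tangent p b2 by exact: (lie_bracket_tangent Hnabla).
have tb3 : tangent p b3 by exact: (lie_bracket_tangent Hnabla).
have tb4 : tangent p b4 by exact: (lie_bracket_tangent Hnabla).
have tI w : tangent p w -> tangent p (conj_by psi J p w).
  by move=> tw; apply: psT; exact: JT.
have AD v w : tangent p v -> tangent p w -> A p (v + w) = A p v + A p w.
  exact: (bundle_mapD (aut_inv_map psi)).
have AN v : tangent p v -> A p (- v) = - A p v.
  exact: (bundle_mapN (aut_inv_map psi)).
have A0 : A p 0 = 0 by exact: (bundle_map0 p (aut_inv_map psi)).
have tJz : tangent p (J p z) by exact: JT.
have tX := psT _ _ tx; have tY := psT _ _ ty.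
have tX' := psT _ _ (JT p x0); have tY' := psT _ _ (JT p y0).
have E1 : dot (A p b1) (J p z) = _ := br _ _ _ vJx vy tJz.
have E2 : dot (A p b2) (J p z) = _ := br _ _ _ vx vJy tJz.
have E3 : dot (A p b3) z = _ := br _ _ _ vx vy tz.
have E4 : dot (A p b4) z = _ := br _ _ _ vJx vJy tz.
(* From here on the brackets enter only through E1-E4. *)
clearbody b1 b2 b3 b4; clear br.
have Jx : act J x p = J p x0 by rewrite /act xp.
have Jy : act J y p = J p y0 by rewrite /act yp.
have DJ := tderiv_J Hcross.
rewrite yp Jx -/ps (DJ _ _ _ vx tY) xp in E1.
rewrite xp Jy -/ps (DJ _ _ _ vy tX) yp in E2.
rewrite xp yp -/ps in E3.
rewrite Jx Jy -/ps (DJ _ _ _ vx tY') (DJ _ _ _ vy tX') xp yp in E4.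
move=> /(congr1 (A p)).
have tI1 := tI _ tb1; have tI2 := tI _ tb2.
have tI12 := tangentD tI1 tI2; have tI123 := tangentD tI12 tb3.
rewrite (AD _ _ tI123 (tangentN tb4)) (AD _ _ tI12 tb3) (AD _ _ tI1 tI2).
rewrite (AN _ tb4) A0 !AI.
move=> /(congr1 (fun w => dot w z)); rewrite !dotE !(dot_J Hcross).
rewrite {}E1 {}E2 {}E3 {}E4 (nijenhuis_identity _ _ _ _ _ _ tx ty tz tX tY).
rewrite !(crossDl Hcross) !dotE; lra.
Qed.

(** Each term of the Nijenhuis tensor contains the almost complex structure an
    even number of times. *)
Lemma nijenhuis_opp (I : S6 R -> 'rV[R]_7 -> 'rV[R]_7) X Y p :
  (forall q v, tangent q v -> I q v = - J q v) ->
  vector_field X -> vector_field Y ->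
  nijenhuis I X Y p = nijenhuis J X Y p.
Proof.
move=> IJ vX vY.
have actI Z : vector_field Z -> act I Z = fun q => - act J Z q.
  by move=> [tZ _]; rewrite funeqE => q; rewrite /act IJ.
have vJX := J_field Hcross vX; have vJY := J_field Hcross vY.
have brl U V : vector_field U -> vector_field V ->
    lie_bracket (fun q => - U q) V p = - lie_bracket U V p.
  move=> [_ sU] [_ sV]; rewrite /lie_bracket tderivN//.
  by rewrite (tderiv_dirN p (U p) sV) opprB opprK addrC.
have brr U V : vector_field U -> vector_field V ->
    lie_bracket U (fun q => - V q) p = - lie_bracket U V p.
  move=> [_ sU] [_ sV]; rewrite /lie_bracket (tderivN p (U p) sV).
  by rewrite (tderiv_dirN p (V p) sU) opprB opprK addrC.
have vNJY := vector_fieldN vJY.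
have T := lie_bracket_tangent Hnabla.
have JN v : J p (- v) = - J p v.
  apply: dot_ext => w.
  by rewrite dotNl !(dot_J Hcross) dotNl.
rewrite /nijenhuis (actI _ vX) (actI _ vY).
rewrite (brl _ _ vJX vY) (brr _ _ vX vJY) (brl _ _ vJX vNJY) (brr _ _ vJX vJY).
have := T _ _ p vX vJY; have := T _ _ p vJX vY.
move: (lie_bracket (act J X) Y p) (lie_bracket X (act J Y) p).
move: (lie_bracket X Y p) (lie_bracket _ _ p) => b1 b2 b3 b4 t3 t4.
by rewrite (IJ _ _ (tangentN t3)) (IJ _ _ (tangentN t4)) !JN !opprK.
Qed.

Lemma id_bundle_map : bundle_map (fun (_ : S6 R) (v : 'rV[R]_7) => v).
Proof.
split=> // t; exists setT, snd; split=> //; first exact: openT.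
move=> k; apply: Ck_on_linear => // x; exact: cvg_snd.
Qed.

Definition id_aut : tangent_aut R :=
  TangentAut id_bundle_map id_bundle_map
    (fun _ _ _ => erefl) (fun _ _ _ => erefl).

(** The identity is a Codazzi map which conjugates J to itself, and for it the
    anticommutator is 2J, which is injective on tangent vectors. *)
Lemma standard_J_nonintegrable : ~ integrable_acs J.
Proof.
move=> HJ.
have cod : codazzi nabla id_aut by move=> X Y _ _ p; rewrite !subrr.
pose e : 'rV[R]_7 := delta_mx 0 0.
have e1 : enorm e == 1.
  rewrite /enorm /dot (bigD1 ord0)//= big1 ?addr0 => [|i i0].
    by rewrite mxE !eqxx mulr1 sqrtr1.
  by rewrite mxE (negbTE i0) andbF mulr0.
pose p : S6 R := exist _ e e1.
have [v v0 [pv _ _]] := exists_orthogonal3 e 0 0.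
have tv : tangent p v by exact/eqP.
have : J p v + J p v = 0.
  exact: codazzi_integrable_anticommute cod HJ tv.
move=> JJ0; have Jv0 : J p v = 0.
  by apply: dot_ext => w; move/(congr1 (fun u => dot u w)): JJ0; rewrite !dotE; lra.
have := JJ Hcross tv; rewrite Jv0 {1}/standard_J.
move=> E; case/eqP: v0; apply: dot_ext => w.
move/(congr1 (fun u => dot u (- w))): E; rewrite dotNr.
rewrite -/(J p 0) (dot_J Hcross) !dotE; lra.
Qed.

End Nijenhuis.

Theorem theorem4p7 (R : realType)
    (cross : 'rV[R]_7 -> 'rV[R]_7 -> 'rV[R]_7)
    (Hcross : cross_product cross)
    (nabla : (S6 R -> 'rV[R]_7) -> (S6 R -> 'rV[R]_7) -> (S6 R -> 'rV[R]_7))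
    (Hnabla : is_levi_civita (@round_metric R) nabla)
    (psi : tangent_aut R)
    (Hpsi : codazzi nabla psi) :
  ~ integrable_acs (conj_by psi (standard_J cross)).
Proof.
move=> Hint; apply: (standard_J_nonintegrable Hcross Hnabla) => X Y vX vY p.
rewrite -(nijenhuis_opp Hcross Hnabla _ _ vX vY (I := conj_by psi (standard_J cross))).
  exact: Hint.
move=> q v tv; have tA := bundle_map_tangent (aut_inv_map psi) tv.
have := codazzi_integrable_anticommute Hcross Hnabla Hpsi Hint tA.
by rewrite aut_invK// => /eqP; rewrite addr_eq0 => /eqP.
Qed.
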